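(* Let $\mathcal{H}$ be a real, infinite-dimensional, separable Hilbert space and let $A\in\mathcal{L}(\mathcal{H})$. Then the following statements are equivalent: (i) For all frames $\{f_n : n\in\mathbb{N}\}$ in $\mathcal{H}$, the family $\{f_n+iAf_n : n\in\mathbb{N}\}$ is a frame in $\mathcal{H}+i\mathcal{H}$. (ii) There exists a frame $\{f_n : n\in\mathbb{N}\}$ in $\mathcal{H}$ such that the family $\{f_n+iAf_n : n\in\mathbb{N}\}$ is a frame in $\mathcal{H}+i\mathcal{H}$. (iii) $i\notin\sigma_{\mathrm{sur}}(A)$. (iv) $-i\notin\sigma_{\mathrm{app}}(A^* )$.
   Context: $\mathcal{H}+i\mathcal{H}$ is the complexification of the real Hilbert space $\mathcal{H}$: the complex Hilbert space of all $f_r+if_i$ with $f_r,f_i\in\mathcal{H}$ and inner product $\langle f_r+if_i,g_r+ig_i\rangle=\langle f_r,g_r\rangle_{\mathcal{H}}+\langle f_i,g_i\rangle_{\mathcal{H}}+i(\langle f_i,g_r\rangle_{\mathcal{H}}-\langle f_r,g_i\rangle_{\mathcal{H}})$. $\mathcal{L}(\mathcal{H})$ is the space of bounded linear operators $\mathcal{H}\to\mathcal{H}$; such an operator acts on $\mathcal{H}+i\mathcal{H}$ by $A(f_r+if_i)=Af_r+iAf_i$, and the spectra below are those of this extension. A family $\{f_n : n\in\mathbb{N}\}$ (repetitions allowed) in a real or complex Hilbert space $X$ is a frame in $X$ if there are constants $0<c\le C<\infty$ with $c\|f\|^2\le\sum_{n\in\mathbb{N}}|\langle f,f_n\rangle|^2\le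 C\|f\|^2$ for all $f\in X$. For a bounded operator $A$ on $X$: the surjectivity spectrum is $\sigma_{\mathrm{sur}}(A)=\{\lambda\in\mathbb{C} : (A-\lambda\,\mathrm{Id})X\neq X\}$; the approximate point spectrum $\sigma_{\mathrm{app}}(A)$ is the set of $\lambda\in\mathbb{C}$ for which there is a sequence $(x_n)$ in $X$ with $\|x_n\|=1$ for all $n$ and $\lim_{n\to\infty}\|Ax_n-\lambda x_n\|=0$. *)

(* Defs.v *)
From HB Require Import structures.
From mathcomp Require Import all_boot all_order all_algebra complex.
From mathcomp Require Import all_classical all_reals all_analysis.
From mathcomp Require Import ring lra.

Set Implicit Arguments.
Unset Strict Implicit.
Unset Printing Implicit Defensive.

Import Order.TTheory GRing.Theory Num.Theory.
Import numFieldNormedType.Exports.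

Local Open Scope classical_set_scope.
Local Open Scope ring_scope.

HB.mixin Record NormedModule_isHilbert (K : numFieldType) (theta : K -> K) H
    & NormedModule K H := {
  inner : {dot H for theta} ;
  sqr_norm_inner : forall x : H, `|x| ^+ 2 = inner x x
}.

#[short(type="hilbertType")]
HB.structure Definition Hilbert (K : numFieldType) (theta : K -> K) :=
  {H of CompleteNormedModule K H & NormedModule_isHilbert K theta H}.

Arguments inner {K theta s}.

(* Forms are linear in the first argument and theta-linear in the second. *)
Notation realHilbertType R := (@hilbertType R idfun).
Notation complexHilbertType R := (@hilbertType R[i] (@conjc R)).

Definition infinite_dimensional (K : fieldType) (V : lmodType K) : Prop :=
  ~ exists n (e : 'I_n -> V), forall x, exists c : 'I_n -> K,
      x = \sum_(i < n) c i *: e i.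

Definition separable (T : topologicalType) : Prop :=
  exists2 D : set T, countable D & dense D.

Definition bounded_operator (K : numFieldType) (V : normedModType K)
    (A : V -> V) : Prop :=
  exists M : K, forall x, `|A x| <= M * `|x|.

(* For K = R[i] the order relates only numbers with equal imaginary parts, so
   c and C are positive reals there as well. *)
Definition frame (K : numFieldType) (theta : K -> K) (X : hilbertType theta)
    (f : nat -> X) : Prop :=
  exists c C : K, [/\ 0 < c, c <= C & forall x : X,
    let coefs := series (fun n => `|inner x (f n)| ^+ 2) in
    cvgn coefs /\ c * `|x| ^+ 2 <= limn coefs <= C * `|x| ^+ 2].

Definition surjectivity_spectrum (K : numFieldType) (theta : K -> K)
  (X : hilbertType theta) (A : X -> X) : set K :=
  [set l | range (fun x => A x - l *: x) <> [set: X]].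

Definition approximate_point_spectrum (K : numFieldType) (theta : K -> K)
    (X : hilbertType theta) (A : X -> X) : set K :=
  [set l | exists x : nat -> X, (forall n, `|x n| = 1) /\
    `|A (x n) - l *: x n| @[n --> \oo] --> 0].

(* The choice is unique when it exists, and inner_adjoint below shows that it
   exists for bounded linear operators on real Hilbert spaces. *)
Definition adjoint (K : numFieldType) (theta : K -> K) (X : hilbertType theta)
    (A : X -> X) (y : X) : X :=
  xget 0 [set z | forall x, inner (A x) y = inner x z].

Section RealHilbertTheory.
Context {R : realType} {H : realHilbertType R}.
Implicit Types x y z : H.

Lemma inner_sym x y : inner x y = inner y x.
Proof. by have := @hermitian_subproof _ _ _ _ (@inner _ _ H) x y; rewrite expr0 mul1r. Qed.

Lemma innerDl x y z : inner (x + y) z = inner x z + inner y z.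
Proof. by rewrite linearDl. Qed.
Lemma innerNl x z : inner (- x) z = - inner x z.
Proof. by rewrite linearNl. Qed.
Lemma innerNr x z : inner z (- x) = - inner z x.
Proof. by rewrite !(inner_sym z) innerNl. Qed.
Lemma innerBl x y z : inner (x - y) z = inner x z - inner y z.
Proof. by rewrite linearBl. Qed.
Lemma innerZl a x z : inner (a *: x) z = a * inner x z.
Proof. by rewrite linearZl_LR. Qed.
Lemma innerDr x y z : inner z (x + y) = inner z x + inner z y.
Proof. by rewrite !(inner_sym z) innerDl. Qed.
Lemma innerBr x y z : inner z (x - y) = inner z x - inner z y.
Proof. by rewrite !(inner_sym z) innerBl. Qed.
Lemma innerZr a x z : inner z (a *: x) = a * inner z x.
Proof. by rewrite !(inner_sym z) innerZl. Qed.

Lemma sqr_normD x y : `|x + y| ^+ 2 = `|x| ^+ 2 + 2 * inner x y + `|y| ^+ 2.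
Proof. by rewrite !sqr_norm_inner innerDl !innerDr (inner_sym y x); ring. Qed.

Lemma sqr_normB x y : `|x - y| ^+ 2 = `|x| ^+ 2 - 2 * inner x y + `|y| ^+ 2.
Proof. by rewrite sqr_normD innerNr normrN; ring. Qed.

Lemma cauchy_schwarz x y : `|inner x y| <= `|x| * `|y|.
Proof.
have [->|y0] := eqVneq y 0.
  by rewrite -(scale0r 0) innerZr mul0r normr0 mulr_ge0.
have ny : 0 < `|y| ^+ 2 by rewrite exprn_gt0 ?normr_gt0.
rewrite -ler_sqr ?nnegrE ?mulr_ge0 // real_normK ?num_real // exprMn.
have := sqr_ge0 `| `|y| ^+ 2 *: x - inner x y *: y|.
rewrite sqr_normB !normrZ !exprMn innerZl innerZr !real_normK ?num_real //.
set a := `|y| ^+ 2 in ny *; set b := `|x| ^+ 2; set d := inner x y.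
rewrite (_ : _ + _ = a * (b * a - d ^+ 2)); last by ring.
by rewrite pmulr_rge0 // subr_ge0.
Qed.

(* Riesz representation: the representing vector is the limit of a minimizing
   sequence of x |-> `|x| ^+ 2 - 2 * phi x. *)
Lemma riesz_representation (phi : H -> R) (M : R) :
  (forall x y, phi (x + y) = phi x + phi y) ->
  (forall a x, phi (a *: x) = a * phi x) ->
  (forall x, `|phi x| <= M * `|x|) ->
  exists z, forall x, phi x = inner x z.
Proof.
move=> phiD phiZ phiM.
pose J x := `|x| ^+ 2 - 2 * phi x.
have JM x : - M ^+ 2 <= J x.
  have := phiM x; rewrite ler_norml => /andP[_ h]; rewrite /J.
  have := sqr_ge0 (`|x| - M); nra.
have infJ : has_inf (range J).
  by split; [exists (J 0), 0 | exists (- M ^+ 2) => _ [x _ <-]].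
pose m := inf (range J).
have mJ x : m <= J x by apply: ge_inf; [case: infJ | exists x].
have exJ (e : R) : 0 < e -> exists x, J x < m + e.
  by move=> e0; have [_ [x _ <-] ?] := inf_adherent e0 infJ; exists x.
have distJ x y : `|x - y| ^+ 2 <= 2 * (J x - m) + 2 * (J y - m).
  have := mJ (2^-1 *: (x + y)); rewrite /J phiZ phiD normrZ exprMn (sqr_normB x y) (sqr_normD x y).
  rewrite ger0_norm ?invr_ge0 //; lra.
have devJ x h (e : R) : 0 < e -> J x < m + e ^+ 2 ->
    `|inner x h - phi h| <= `|h| * e.
  move=> e0 Jx; have [->|h0] := eqVneq h 0.
    rewrite -(scale0r 0) innerZr phiZ !mul0r subrr normr0.
    by rewrite mulr_ge0 // ltW.
  have nh : 0 < `|h| ^+ 2 by rewrite exprn_gt0 ?normr_gt0.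
  rewrite -ler_sqr ?nnegrE ?mulr_ge0 ?(ltW e0) // real_normK ?num_real // exprMn.
  set d := inner x h - phi h.
  have := mJ (x + (- (d / `|h| ^+ 2)) *: h).
  rewrite /J phiD phiZ sqr_normD innerZr normrZ exprMn real_normK ?num_real //.
  move: Jx; rewrite /J; set a := `|h| ^+ 2 in nh *; set p := `|x| ^+ 2.
  have -> : inner x h = d + phi h by rewrite /d subrK.
  move=> Jx hm; have {hm} : m <= p - 2 * phi x - d ^+ 2 / a.
    apply: le_trans hm _; rewrite le_eqVlt; apply/orP; left; apply/eqP.
    by field; rewrite gt_eqF.
  move=> hm; have : d ^+ 2 / a <= e ^+ 2 by lra.
  by rewrite ler_pdivrMr // mulrC.
have x_ n : {x | J x < m + n.+1%:R^-1} by apply/cid/exJ; rewrite invr_gt0.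
pose u n := sval (x_ n).
have uJ n : J (u n) < m + n.+1%:R^-1 by rewrite /u; case: (x_ n).
have uJe (e : R) : 0 < e -> \forall n \near \oo, J (u n) < m + e.
  move=> e0; near=> n; apply: lt_le_trans (uJ n) _; rewrite lerD2l.
  by apply: ltW; near: n; exact: near_infty_natSinv_lt (PosNum e0).
have /cvg_ex[/= z uz] : cvg (u @ \oo).
  apply: cauchy_cvg; apply/cauchy_ballP => e e0.
  have e4 : 0 < e ^+ 2 / 4 by rewrite divr_gt0 ?exprn_gt0.
  exists ((u @` [set n | J (u n) < m + e ^+ 2 / 4]),
          (u @` [set n | J (u n) < m + e ^+ 2 / 4])) => /=.
    by split; apply: filterS (uJe _ e4) => n Jn; exists n.
  move=> [_ _] /= [[k Jk <-] [l Jl <-]]; rewrite -ball_normE /=.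
  rewrite -ltr_sqr ?nnegrE ?(ltW e0) //; apply: le_lt_trans (distJ _ _) _.
  by move: Jk Jl => /= Jk Jl; lra.
exists z => h; apply/esym/eqP; rewrite -subr_eq0 -normr_le0.
apply/ler_addgt0Pr => e e0; rewrite add0r.
pose d := e / (2 * (`|h| + 1)).
have h1 : 0 < `|h| + 1 by rewrite ltr_wpDl.
have d0 : 0 < d by rewrite divr_gt0 // mulr_gt0.
near \oo => n.
have Jn : J (u n) < m + d ^+ 2 by near: n; apply: uJe; rewrite exprn_gt0.
have zn : `|z - u n| < d by near: n; move/cvgrPdist_lt : uz; exact.
have -> : inner h z - phi h = inner h (z - u n) + (inner (u n) h - phi h).
  by rewrite innerBr (inner_sym (u n)); ring.
apply: le_trans (ler_normD _ _) _.
have A1 := cauchy_schwarz h (z - u n).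
have A2 := devJ _ h _ d0 Jn.
have A3 : `|h| * `|z - u n| <= `|h| * d by rewrite ler_wpM2l // ltW.
have A4 : `|h| * d * 2 <= e.
  rewrite /d (_ : _ * _ * 2 = e * (`|h| / (`|h| + 1))); last first.
    by field; rewrite gt_eqF.
  by rewrite ger_pMr // ler_pdivrMr // mul1r lerDl.
lra.
Unshelve. all: by end_near. Qed.

Lemma inner_adjoint (A : {linear H -> H}) : bounded_operator A ->
  forall x y, inner (A x) y = inner x (adjoint A y).
Proof.
move=> [M AM] x y; apply: (@xgetPex _ 0 [set z | forall x, inner (A x) y = inner x z]).
apply: (@riesz_representation (fun x => inner (A x) y) (M * `|y|)).
- by move=> a b; rewrite linearD innerDl.
- by move=> a b; rewrite linearZ innerZl.
- move=> a; apply: le_trans (cauchy_schwarz _ _) _.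
  by rewrite mulrAC ler_wpM2r.
Qed.

End RealHilbertTheory.

Local Open Scope complex_scope.

(* Cplx f g stands for f + i g. *)
Record complexification (R : realType) (H : realHilbertType R) :=
  Cplx { rpart : H ; ipart : H }.
Arguments Cplx {R H}.

Section Complexification.
Context {R : realType} {H : realHilbertType R}.
Local Notation HC := (complexification H).

Lemma pair_of_complexificationK :
  cancel (fun u : HC => (rpart u, ipart u)) (fun p => Cplx p.1 p.2).
Proof. by case. Qed.

HB.instance Definition _ := Equality.copy HC (can_type pair_of_complexificationK).
HB.instance Definition _ := Choice.copy HC (can_type pair_of_complexificationK).

Lemma complexification_eq (u v : HC) :
  rpart u = rpart v -> ipart u = ipart v -> u = v.
Proof. by case: u v => [? ?] [? ?] /= -> ->. Qed.

Let add (u v : HC) := Cplx (rpart u + rpart v) (ipart u + ipart v).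
Let opp (u : HC) := Cplx (- rpart u) (- ipart u).

Let addA : associative add.
Proof. by move=> u v w; apply: complexification_eq; exact: addrA. Qed.
Let addC : commutative add.
Proof. by move=> u v; apply: complexification_eq; exact: addrC. Qed.
Let add0 : left_id (Cplx 0 0) add.
Proof. by move=> u; apply: complexification_eq; exact: add0r. Qed.
Let addN : left_inverse (Cplx 0 0) opp add.
Proof. by move=> u; apply: complexification_eq; exact: addNr. Qed.

HB.instance Definition _ := GRing.isZmodule.Build HC addA addC add0 addN.

Let scale (l : R[i]) (u : HC) : HC :=
  Cplx (complex.Re l *: rpart u - complex.Im l *: ipart u) (complex.Im l *: rpart u + complex.Re l *: ipart u).

Let scaleA (k l : R[i]) (u : HC) : scale k (scale l u) = scale (k * l) u.
Proof.
case: k l u => [a b] [c d] [f g]; apply: complexification_eq => /=.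
- rewrite scalerBr scalerDr scalerBl scalerDl !scalerA !opprD !addrA.
  by congr (_ - _); rewrite addrAC.
- rewrite scalerBr scalerDr scalerBl scalerDl !scalerA addrACA.
  by rewrite [b * c *: f + _]addrC [- _ + _]addrC.
Qed.
Let scale1 : left_id 1 scale.
Proof. by case=> f g; apply: complexification_eq => /=; rewrite !scale1r !scale0r ?subr0 ?add0r. Qed.
Let scaleDr : right_distributive scale +%R.
Proof.
case=> [a b] [f g] [f' g']; apply: complexification_eq => /=; rewrite !scalerDr.
- by rewrite opprD addrACA.
- by rewrite addrACA.
Qed.
Let scaleDl v : {morph scale^~ v : k l / k + l}.
Proof.
move=> [a b] [c d]; case: v => f g; apply: complexification_eq => /=; rewrite !scalerDl.
- by rewrite opprD addrACA.
- by rewrite addrACA.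
Qed.

HB.instance Definition _ :=
  GRing.Zmodule_isLmodule.Build R[i] HC scaleA scale1 scaleDr scaleDl.

Definition cinner (u v : HC) : R[i] :=
  (inner (rpart u) (rpart v) + inner (ipart u) (ipart v)) +i*
  (inner (ipart u) (rpart v) - inner (rpart u) (ipart v)).

Definition cnorm (u : HC) : R[i] :=
  (Num.sqrt (`|rpart u| ^+ 2 + `|ipart u| ^+ 2))%:C.

Lemma sqr_cnorm u : cnorm u ^+ 2 = cinner u u.
Proof.
rewrite /cnorm /cinner -rmorphXn /= sqr_sqrtr; last by rewrite addr_ge0 ?sqr_ge0.
by rewrite !sqr_norm_inner [inner (ipart u) (rpart u)]inner_sym subrr.
Qed.

Lemma ler_cnormD u v : cnorm (u + v) <= cnorm u + cnorm v.
Proof.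
rewrite /cnorm -rmorphD lecR /=.
have := le_normcD (`|rpart u| +i* `|ipart u|) (`|rpart v| +i* `|ipart v|).
apply: le_trans => /=; rewrite ler_sqrt; last by rewrite addr_ge0 ?sqr_ge0.
by apply: lerD; rewrite ler_sqr ?nnegrE ?addr_ge0 ?ler_normD.
Qed.

Lemma cnormZ l u : cnorm (l *: u) = `|l| * cnorm u.
Proof.
rewrite normc_def /cnorm -rmorphM /= -sqrtrM ?addr_ge0 ?sqr_ge0 //.
congr (Num.sqrt _)%:C; rewrite !sqr_norm_inner.
rewrite !(innerDl, innerNl, innerDr, innerNr, innerZl, innerZr).
rewrite [inner (ipart u) (rpart u)]inner_sym.
by move: (complex.Re l) (complex.Im l) => a b; ring.
Qed.

Lemma cnorm0_eq0 u : cnorm u = 0 -> u = 0.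
Proof.
move=> [] /eqP; rewrite sqrtr_eq0 => h.
have h0 := addr_ge0 (sqr_ge0 `|rpart u|) (sqr_ge0 `|ipart u|).
have /eqP : `|rpart u| ^+ 2 + `|ipart u| ^+ 2 == 0 by rewrite eq_le h h0.
move=> /eqP; rewrite paddr_eq0 ?sqr_ge0 // !sqrf_eq0 !normr_eq0 => /andP[/eqP a /eqP b].
exact: complexification_eq.
Qed.

HB.instance Definition _ :=
  Lmodule_isNormed.Build R[i] HC ler_cnormD cnormZ cnorm0_eq0.

Let cinnerDl v : zmod_morphism (cinner^~ v).
Proof.
by move=> u w; apply/eqP; rewrite eq_complex /= !innerBl; apply/andP; split; apply/eqP; ring.
Qed.
Let cinnerDr v : zmod_morphism (cinner v).
Proof.
by move=> u w; apply/eqP; rewrite eq_complex /= !innerBr; apply/andP; split; apply/eqP; ring.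
Qed.
Let cinnerZl v : scalable_for *%R (cinner^~ v).
Proof.
move=> [a b] u; apply/eqP; rewrite eq_complex /= !(innerDl, innerNl, innerZl).
by apply/andP; split; apply/eqP; ring.
Qed.
Let cinnerZr v : scalable_for (@conjc R \; *%R) (cinner v).
Proof.
move=> [a b] u; apply/eqP; rewrite eq_complex /= !(innerDr, innerNr, innerZr).
by apply/andP; split; apply/eqP; ring.
Qed.

HB.instance Definition _ := isBilinear.Build R[i] HC HC R[i] *%R
  (@conjc R \; *%R) cinner cinnerDl cinnerDr cinnerZl cinnerZr.

Let cinner_herm u v : cinner u v = (-1) ^+ false * (cinner v u)^*.
Proof.
rewrite expr0 mul1r; apply/eqP; rewrite eq_complex /= opprB.
rewrite (inner_sym (rpart v)) (inner_sym (ipart v)).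
by rewrite (inner_sym (rpart v)) (inner_sym (ipart v)) !eqxx.
Qed.

HB.instance Definition _ :=
  isHermitianSesquilinear.Build R[i] HC false (@conjc R) cinner cinner_herm.

Let cinner_gt0 u : u != 0 -> 0 < cinner u u.
Proof.
by move=> u0; rewrite -sqr_cnorm; apply: exprn_gt0; rewrite (_ : cnorm u = `|u|) // normr_gt0.
Qed.

HB.instance Definition _ := isDotProduct.Build R[i] HC cinner cinner_gt0.

Let cinnerE (u : HC) : `|u| ^+ 2 = cinner u u. Proof. exact: sqr_cnorm. Qed.

Let norm_rpart_le (u : HC) : `|rpart u|%:C <= `|u|.
Proof.
rewrite (_ : `|u| = cnorm u) // lecR -[leLHS]normr_id -sqrtr_sqr.
by rewrite ler_sqrt ?addr_ge0 ?sqr_ge0 // lerDl sqr_ge0.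
Qed.
Let norm_ipart_le (u : HC) : `|ipart u|%:C <= `|u|.
Proof.
rewrite (_ : `|u| = cnorm u) // lecR -[leLHS]normr_id -sqrtr_sqr.
by rewrite ler_sqrt ?addr_ge0 ?sqr_ge0 // lerDr sqr_ge0.
Qed.
Let norm_le_parts (u : HC) : `|u| <= (`|rpart u| + `|ipart u|)%:C.
Proof.
have uE : u = Cplx (rpart u) 0 + Cplx 0 (ipart u).
  by apply: complexification_eq => /=; rewrite ?addr0 ?add0r.
rewrite {1}uE (le_trans (ler_normD _ _)) // rmorphD /=.
have nE (v : HC) : `|v| = cnorm v by [].
rewrite !nE /cnorm /= normr0 expr0n addr0 add0r !sqrtr_sqr !normr_id.
exact: lexx.
Qed.

Let parts_cvg (F : set_system HC) (g : HC -> H) : ProperFilter F -> cauchy F ->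
  (forall u v, g (u - v) = g u - g v) -> (forall u, `|g u|%:C <= `|u|) ->
  cvg (g @ F).
Proof.
move=> FF Fc gB gle; apply: cauchy_cvg; apply/cauchy_ballP => e e0.
have e0' : 0 < e%:C :> R[i] by rewrite ltcR.
move: Fc => /cauchy_ballP /(_ _ e0').
move=> [[P Q] /= [FP FQ] PQ]; exists (g @` P, g @` Q) => /=.
  split.
    by apply: filterS FP => x Px; exists x.
  by apply: filterS FQ => x Px; exists x.
move=> [_ _] /= [[x Px <-] [y Qy <-]].
have := PQ (x, y) (conj Px Qy); rewrite -!ball_normE /= => xy.
by rewrite -ltcR -gB; apply: le_lt_trans xy; exact: gle.
Qed.

Lemma complexification_complete (F : set_system HC) :
  ProperFilter F -> cauchy F -> cvg F.
Proof.
move=> FF Fc.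
have /cvg_ex[/= a Fa] : cvg (@rpart R H @ F) by exact: parts_cvg.
have /cvg_ex[/= b Fb] : cvg (@ipart R H @ F) by exact: parts_cvg.
apply/cvg_ex; exists (Cplx a b); apply/cvgrPdist_lt => -[e e'] /=.
rewrite ltcE /= => /andP[/eqP -> e0].
have e20 : 0 < e / 2 by rewrite divr_gt0.
near=> u.
apply: (le_lt_trans (norm_le_parts _)); rewrite ltcR /= (splitr e) ltrD //.
  by near: u; move/cvgrPdist_lt : Fa => /(_ _ e20).
by near: u; move/cvgrPdist_lt : Fb => /(_ _ e20).
Unshelve. all: by end_near. Qed.

HB.instance Definition _ := Uniform_isComplete.Build HC complexification_complete.
HB.instance Definition _ :=
  @NormedModule_isHilbert.Build R[i] (@conjc R) HC cinner cinnerE.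

End Complexification.

Definition extend (R : realType) (H : realHilbertType R) (A : H -> H)
    (u : complexification H) : complexification H :=
  Cplx (A (rpart u)) (A (ipart u)).

(* Main.v *)
(* Write T for the adjoint of A. For g = a + i b the real and imaginary parts
   of <g, f_n + i A f_n> are <a + T b, f_n> and <b - T a, f_n>, the frame
   coefficients of the two components of (T + i) g, up to sign and order. So,
   for any frame (f_n) of H, the family (f_n + i A f_n) is a frame if and only
   if T + i is bounded below, a condition independent of (f_n) that says
   exactly that - i is not in the approximate point spectrum of T. An
   operator is surjective if and only if its adjoint is bounded below (by
   Banach-Steinhaus and by a contraction argument); eliminating one of the two
   components of A - i reduces this to the real operator A^2 + 1. That H has a
   frame at all follows by running Gram-Schmidt on a dense sequence. *)
Require Import Defs.
From mathcomp Require Import all_boot all_order all_algebra complex.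
From mathcomp Require Import all_classical all_reals all_analysis.
From mathcomp Require Import ring lra.

Set Implicit Arguments.
Unset Strict Implicit.
Unset Printing Implicit Defensive.

Import Order.TTheory GRing.Theory Num.Theory.
Import numFieldNormedType.Exports.

Local Open Scope classical_set_scope.
Local Open Scope ring_scope.

(** * Adjoint pairs and the closed range theorem *)

Section RealHilbert.
Context {R : realType} {H : realHilbertType R}.
Implicit Types x y z : H.

Lemma inner0l x : inner 0 x = 0.
Proof. by rewrite -(scale0r 0) innerZl mul0r. Qed.

Lemma inner_eq0 x : inner x x = 0 -> x = 0.
Proof. by rewrite -sqr_norm_inner => /eqP; rewrite sqrf_eq0 normr_eq0 => /eqP. Qed.

Lemma inner_inj y z : (forall x, inner x y = inner x z) -> y = z.
Proof.
move=> yz; apply/eqP; rewrite -subr_eq0; apply/eqP/inner_eq0.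
by rewrite innerBr yz subrr.
Qed.

Section AdjointPair.
Variables S T : H -> H.
Hypothesis adjST : forall x y, inner (S x) y = inner x (T y).

(** [T] is a bare function here: its linearity is read off the adjoint identity. The Gram-Schmidt
    projections reuse this with [S] equal to [T]. *)
Lemma adjointD x y : T (x + y) = T x + T y.
Proof. by apply: inner_inj => u; rewrite innerDr -!adjST innerDr. Qed.

Lemma adjointZ a x : T (a *: x) = a *: T x.
Proof. by apply: inner_inj => u; rewrite innerZr -!adjST innerZr. Qed.

Lemma adjointN x : T (- x) = - T x.
Proof. by rewrite -scaleN1r adjointZ scaleN1r. Qed.

Lemma adjointB x y : T (x - y) = T x - T y.
Proof. by rewrite adjointD adjointN. Qed.

Lemma adjoint_bounded (M : R) : (forall x, `|S x| <= M * `|x|) ->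
  forall y, `|T y| <= M * `|y|.
Proof.
move=> S_bounded y.
have [->|T0] := eqVneq (T y) 0.
  by rewrite normr0 (le_trans _ (S_bounded y)).
rewrite -(@ler_pM2r _ `|T y|) ?normr_gt0 // -expr2 sqr_norm_inner -adjST.
apply: le_trans (ler_norm _) _; apply: le_trans (cauchy_schwarz _ _) _.
by rewrite mulrAC ler_wpM2r.
Qed.

End AdjointPair.

Section ClosedRange.
Variables (S : {linear H -> H}) (T : H -> H) (M : R).
Hypothesis S_bounded : forall x, `|S x| <= M * `|x|.
Hypothesis adjST : forall x y, inner (S x) y = inner x (T y).

(* x = T u, where u is the fixed point of the Richardson iteration
   u |-> u - t (S T u - y), a contraction for small t. *)
Lemma adjoint_bounded_below_surjective (c : R) : 0 < c ->
  (forall y, c * `|y| <= `|T y|) -> forall y, exists x, S x = y.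
Proof.
move=> c0 cT y.
(* This [t] gives t M^2 <= 1 and t c^2 <= 1, so that |w - t S T w|^2 <= |w|^2 - t |T w|^2 <= (1 - t
   c^2) |w|^2. *)
pose d := M ^+ 2 + c ^+ 2 + 1; pose t := d^-1.
have d0 : 0 < d by rewrite /d ltr_wpDl // addr_ge0 // sqr_ge0.
have t0 : 0 < t by rewrite invr_gt0.
have td : t * d = 1 by rewrite mulVf // gt_eqF.
have tM : t * M ^+ 2 <= 1.
  by rewrite -td ler_pM2l // /d; have := sqr_ge0 c; lra.
have tc : 0 <= 1 - t * c ^+ 2.
  by rewrite -td -mulrBr mulr_ge0 ?(ltW t0) // /d; have := sqr_ge0 M; lra.
pose q := Num.sqrt (1 - t * c ^+ 2).
have q0 : 0 <= q by exact: sqrtr_ge0.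
have q1 : q < 1.
  rewrite -sqrtr1 ltr_sqrt // ltrBlDr ltrDl mulr_gt0 // exprn_gt0 //.
pose phi u := u - t *: (S (T u) - y).
have phi_contr u v : `|phi u - phi v| <= q * `|u - v|.
  have -> : phi u - phi v = (u - v) - t *: S (T (u - v)).
    rewrite (adjointB adjST) [S _]linearB /phi; move: (S (T u)) (S (T v)) => a b.
    rewrite (_ : a - b = (a - y) - (b - y)); last by rewrite opprB addrA subrK.
    rewrite [t *: (a - y - _)]scalerBr; move: (t *: (a - y)) (t *: (b - y)) => p p'.
    by rewrite !opprB [p' - v]addrC addrACA [- p + p']addrC.
  set w := u - v.
  rewrite -ler_sqr ?nnegrE ?mulr_ge0 // exprMn sqr_sqrtr //.
  rewrite sqr_normB innerZr inner_sym adjST -sqr_norm_inner normrZ exprMn (gtr0_norm t0).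
  have h1 : `|S (T w)| ^+ 2 <= M ^+ 2 * `|T w| ^+ 2.
    rewrite -exprMn lerXn2r ?nnegrE //; exact: le_trans (S_bounded _).
  have h2 : c ^+ 2 * `|w| ^+ 2 <= `|T w| ^+ 2.
    by rewrite -exprMn lerXn2r ?nnegrE // mulr_ge0 // ltW.
  have h3 : t ^+ 2 * `|S (T w)| ^+ 2 <= t * `|T w| ^+ 2.
    rewrite expr2 -mulrA ler_pM2l //.
    apply: le_trans (_ : t * (M ^+ 2 * `|T w| ^+ 2) <= _).
      by rewrite ler_pM2l.
    by rewrite mulrA ler_piMl // sqr_ge0.
  have h4 : t * (c ^+ 2 * `|w| ^+ 2) <= t * `|T w| ^+ 2 by rewrite ler_pM2l.
  lra.
pose f : {fun [set: H] >-> [set: H]} := mkfun_fun (fun u _ => I : setT (phi u)).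
have [|||u _ uf] := @banach_fixed_point R H setT f.
- by exists (NngNum q0); split => //= -[u v] _ /=; exact: phi_contr.
- exact: closedT.
- by exists 0.
exists (T u); move/eqP: uf; rewrite /f /= /phi eq_sym -subr_eq0 addrAC subrr add0r oppr_eq0.
by rewrite scaler_eq0 gt_eqF //= subr_eq0 => /eqP.
Qed.

(** Writing x = S u gives <x, h> = <u, T h>, so the functionals <., h> with |T h| <= 1 are pointwise
    bounded. Banach-Steinhaus bounds these [h] uniformly, and scaling yields the lower bound. *)
Lemma surjective_adjoint_bounded_below :
  (forall y, exists x, S x = y) ->
  exists2 c : R, 0 < c & forall y, c * `|y| <= `|T y|.
Proof.
move=> Ssurj.
pose F : set (H -> R) := [set f | exists2 h, `|T h| <= 1 & f = fun x => inner x h].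
have FP f : F f -> bounded_fun_norm (f : H -> R^o) /\ linear (f : H -> R^o).
  move=> [h _ ->]; split=> [r|a x y]; last by rewrite innerDl innerZl.
  exists (r * `|h|) => x xr; apply: le_trans (cauchy_schwarz _ _) _.
  by rewrite ler_wpM2r.
have Fpt : pointwise_bounded (F : set (H -> R^o)).
  move=> x; have [u <-] := Ssurj x; exists `|u| => _ [h Th ->].
  rewrite adjST; apply: le_trans (cauchy_schwarz _ _) _.
  by rewrite ler_piMr.
have [C FC] := Banach_Steinhauss FP Fpt 1.
have hC h : `|T h| <= 1 -> `|h| <= C.
  move=> Th; have [->|h0] := eqVneq h 0.
    have := FC _ (ex_intro2 _ _ 0 _ erefl) 0.
    rewrite inner0l !normr0; apply => //.
    by rewrite -(scale0r 0) (adjointZ adjST) scale0r normr0.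
  have nh : 0 < `|h| by rewrite normr_gt0.
  have := FC _ (ex_intro2 _ _ h Th erefl) (`|h|^-1 *: h).
  rewrite innerZl -sqr_norm_inner expr2 mulKf ?gt_eqF // normr_id; apply.
  by rewrite normrZ normfV normr_id mulVf // gt_eqF.
have C0 : 0 <= C.
  by apply: le_trans (hC 0 _) => //; rewrite -(scale0r 0) (adjointZ adjST) scale0r normr0.
exists (C + 1)^-1; first by rewrite invr_gt0 ltr_wpDl.
move=> y; rewrite mulrC ler_pdivrMr ?ltr_wpDl //.
have [T0|T0] := eqVneq (T y) 0.
  rewrite T0 normr0 mul0r.
  (* If T y = 0, every multiple of [y] must have norm at most [C]; a multiple of norm C + 1 rules
     out y != 0. *)
  have := hC ((C + 1) / `|y| *: y); rewrite (adjointZ adjST) T0 scaler0 normr0 => /(_ ler01).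
  have [->|y0] := eqVneq y 0; first by rewrite normr0.
  rewrite normrZ normrM normfV normr_id -mulrA mulVf ?normr_eq0 // mulr1 ger0_norm; lra.
have nT : 0 < `|T y| by rewrite normr_gt0.
have := hC (`|T y|^-1 *: y); rewrite (adjointZ adjST) !normrZ normfV normr_id mulVf ?gt_eqF //.
move=> /(_ (lexx _)); rewrite mulrC ler_pdivrMr // => h.
by rewrite mulrDr mulr1 mulrC (le_trans h) // lerDl.
Qed.

End ClosedRange.
End RealHilbert.

(** * Gram-Schmidt and the existence of a Parseval frame *)

Section ParsevalFrame.
Context {R : realType} {H : realHilbertType R}.
Implicit Types x y z : H.

Lemma separable_dense_sequence : separable H ->
  exists d : nat -> H, forall x (e : R), 0 < e -> exists n, `|x - d n| < e.
Proof.
move=> [D /countable_injP[i iI] Dd].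
(* A left inverse of [i] on [D]; indices outside the image of [D] get the harmless value 0. *)
pose d n := xget 0 [set y | D y /\ i y = n].
exists d => x e e0.
have [||z [xz Dz]] := Dd (ball x e).
- by exists x; exact: ballxx.
- exact: ball_open.
exists (i z); have [Dd' id'] : [set y | D y /\ i y = i z] (d (i z)).
  by apply: (@xgetPex _ 0 [set y | D y /\ i y = i z]); exists z.
rewrite (iI _ _ _ _ id') ?inE //.
by move: xz; rewrite -ball_normE.
Qed.

Variable d : nat -> H.

(* gram_schmidt_proj n is the orthogonal projection onto the span of
   d 0, ..., d (n - 1). *)
Fixpoint gram_schmidt_proj n x : H :=
  if n is m.+1 then
    let r := d m - gram_schmidt_proj m (d m) in
    let e := `|r|^-1 *: r in gram_schmidt_proj m x + inner x e *: e
  else 0.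
Local Notation P := gram_schmidt_proj.

(* This vector is 0 when d n depends linearly on its predecessors. *)
Definition gram_schmidt n : H :=
  `|d n - P n (d n)|^-1 *: (d n - P n (d n)).
Local Notation e := gram_schmidt.

Lemma gram_schmidt_projS n x : P n.+1 x = P n x + inner x (e n) *: e n.
Proof. by []. Qed.

Lemma gram_schmidt_proj_sym n x y : inner (P n x) y = inner x (P n y).
Proof.
elim: n => [|n IHn]; first by rewrite inner0l inner_sym inner0l.
rewrite !gram_schmidt_projS innerDl innerDr IHn; move: (e n) => u.
by rewrite innerZl innerZr (inner_sym y) mulrC.
Qed.

(** This form covers both cases at once: [e n] is a unit vector or 0. *)
Lemma gram_schmidt_normalized n : inner (e n) (e n) *: e n = e n.
Proof.
rewrite /e; set r := d n - _; have [->|r0] := eqVneq r 0; first by rewrite !scaler0.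
rewrite innerZl innerZr -sqr_norm_inner expr2 mulKf ?normr_eq0 //.
by rewrite mulVf ?normr_eq0 // scale1r.
Qed.

(** Joint induction: idempotence of [P n] makes it kill [e n], and this orthogonality makes [P n.+1]
    idempotent. *)
Lemma gram_schmidt_proj_idem n :
  (forall x, P n (P n x) = P n x) /\ P n (e n) = 0.
Proof.
have kill m : (forall x, P m (P m x) = P m x) -> P m (e m) = 0.
  move=> idem; have adjP := gram_schmidt_proj_sym m.
  by rewrite (adjointZ adjP) (adjointB adjP) idem subrr scaler0.
elim: n => [|n [idem Pe0]]; first by split.
have adjP := gram_schmidt_proj_sym n.
suff idemS x : P n.+1 (P n.+1 x) = P n.+1 x by split => //; exact: kill.
rewrite !gram_schmidt_projS (adjointD adjP) (adjointZ adjP) idem Pe0 scaler0 addr0.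
rewrite innerDl innerZl adjP Pe0 (inner_sym x 0) inner0l add0r -scalerA.
by rewrite gram_schmidt_normalized.
Qed.

Lemma gram_schmidt_proj_energy n x :
  inner x (P n x) = series (fun k => inner x (e k) ^+ 2) n.
Proof.
elim: n => [|n IHn]; first by rewrite inner_sym inner0l seriesEnat /= big_geq.
by rewrite gram_schmidt_projS innerDr IHn innerZr seriesSr expr2.
Qed.

Lemma sqr_norm_gram_schmidt_residual n x :
  `|x - P n x| ^+ 2 = `|x| ^+ 2 - series (fun k => inner x (e k) ^+ 2) n.
Proof.
rewrite sqr_normB -gram_schmidt_proj_energy [in X in _ + X]sqr_norm_inner.
by rewrite gram_schmidt_proj_sym (gram_schmidt_proj_idem n).1; ring.
Qed.

Lemma gram_schmidt_proj_id m n : (m < n)%N -> P n (d m) = d m.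
Proof.
elim: n => // n IHn; rewrite ltnS leq_eqVlt => /predU1P[->|mn].
  have [idem Pe0] := gram_schmidt_proj_idem n.
  rewrite gram_schmidt_projS.
  (* [e n] is orthogonal to the range of [P n], so only the residual of [d n] contributes, and the
     new term adds exactly that residual back. *)
  have -> : inner (d n) (e n) = inner (d n - P n (d n)) (e n).
    by rewrite innerBl gram_schmidt_proj_sym Pe0 [X in _ - X]inner_sym inner0l subr0.
  rewrite /e; set r := d n - _; have [r0|r0] := eqVneq r 0.
    by rewrite r0 !scaler0 addr0; apply/esym/eqP; rewrite -subr_eq0 -/r r0.
  rewrite innerZr -sqr_norm_inner scalerA expr2 mulKf ?normr_eq0 //.
  by rewrite mulfV ?normr_eq0 // scale1r /r addrC subrK.
rewrite gram_schmidt_projS IHn // -[X in inner X]IHn // gram_schmidt_proj_sym.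
by rewrite (gram_schmidt_proj_idem n).2 inner_sym inner0l scale0r addr0.
Qed.

(** For n > m the residual x - P n x equals that of x - d m, hence has norm at most |x - d m|, which
    density makes small. *)
Lemma gram_schmidt_parseval x :
  (forall (eps : R), 0 < eps -> exists n, `|x - d n| < eps) ->
  series (fun k => inner x (e k) ^+ 2) n @[n --> \oo] --> `|x| ^+ 2.
Proof.
move=> xd; apply/cvgrPdist_lt => eps eps0.
have [m xm] := xd (Num.sqrt eps) (eqbRL (sqrtr_gt0 _) eps0).
near=> n; have mn : (m < n)%N by near: n; exact: nbhs_infty_gt.
rewrite -sqr_norm_gram_schmidt_residual ger0_norm ?sqr_ge0 //.
have -> : x - P n x = (x - d m) - P n (x - d m).
  rewrite (adjointB (gram_schmidt_proj_sym n)) (gram_schmidt_proj_id mn).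
  by rewrite opprB addrA subrK.
rewrite sqr_norm_gram_schmidt_residual.
apply: (@le_lt_trans _ _ (`|x - d m| ^+ 2)).
  rewrite gerBl seriesEnat; apply: sumr_ge0 => k _; exact: sqr_ge0.
rewrite -[ltRHS](sqr_sqrtr (ltW eps0)) ltr_pXn2r ?nnegrE ?sqrtr_ge0 //.
Unshelve. all: by end_near. Qed.

End ParsevalFrame.

Lemma separable_frame (R : realType) (H : realHilbertType R) :
  separable H -> exists f : nat -> H, frame f.
Proof.
move=> /separable_dense_sequence[d dd]; exists (gram_schmidt d).
exists 1, 1; split => // x /=.
under eq_fun do rewrite real_normK ?num_real //.
have xP := gram_schmidt_parseval (dd x).
split; first exact: cvgP xP.
by rewrite (cvg_lim _ xP) // mul1r lexx.
Qed.

(** * Positivity and limits in [R[i]] reduced to [R] *)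

Section RealToComplex.
Local Open Scope complex_scope.

Lemma complex_gt0 (R : rcfType) (z : R[i]) :
  0 < z -> exists2 k : R, 0 < k & z = k%:C.
Proof. by case: z => k k'; rewrite ltcE /= => /andP[/eqP -> k0]; exists k. Qed.

Lemma cvg_real_complex (R : realType) (u : nat -> R) (l : R) :
  u n @[n --> \oo] --> l ->
  ((u n)%:C : (R[i] : numFieldType)) @[n --> \oo] -->
  (l%:C : (R[i] : numFieldType)).
Proof.
move=> ul; apply/cvgrPdist_lt => _ /complex_gt0[e e0 ->]; near=> n.
rewrite -rmorphB /= normc_def /= expr0n addr0 sqrtr_sqr ltcR.
by near: n; move/cvgrPdist_lt : ul; exact.
Unshelve. all: by end_near. Qed.

End RealToComplex.

(** * The operators A - i and T + i on the complexification *)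

Section RotatedSpectrum.
Local Open Scope complex_scope.
Context {R : realType} {H : realHilbertType R}.
Variables (A : {linear H -> H}) (T : H -> H) (M : R).
Hypothesis A_bounded : forall x, `|A x| <= M * `|x|.
Hypothesis adjAT : forall x y, inner (A x) y = inner x (T y).
Implicit Types a b x y : H.

Lemma sqr_norm_Cplx a b : `|Cplx a b| ^+ 2 = (`|a| ^+ 2 + `|b| ^+ 2)%:C.
Proof.
by rewrite (_ : `|Cplx a b| = cnorm (Cplx a b)) // /cnorm -rmorphXn /=
  sqr_sqrtr // addr_ge0 // sqr_ge0.
Qed.

(* The squared norm of (T + i) (a + i b). *)
Definition sqr_norm_rot a b : R := `|a + T b| ^+ 2 + `|b - T a| ^+ 2.

Lemma sqr_norm_inner_rot a b x :
  `|inner (Cplx a b) (Cplx x (A x))| ^+ 2 =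
  (inner (a + T b) x ^+ 2 + inner (b - T a) x ^+ 2)%:C.
Proof.
rewrite (_ : inner _ _ = cinner (Cplx a b) (Cplx x (A x))) // /cinner /=.
rewrite normc_def /= -rmorphXn /= sqr_sqrtr ?addr_ge0 ?sqr_ge0 //.
rewrite !innerDl innerNl (inner_sym b (A x)) (inner_sym a (A x)) !adjAT.
by rewrite (inner_sym x) (inner_sym x).
Qed.

(** Adds the frame inequalities of the two real vectors a + T b and b - T a. *)
Lemma cvg_coefs_rot (f : nat -> H) (c C : R) :
  (forall x, let coefs := series (fun n => `|inner x (f n)| ^+ 2) in
    cvgn coefs /\ c * `|x| ^+ 2 <= limn coefs <= C * `|x| ^+ 2) ->
  forall a b, exists s : R,
    series (fun n => `|inner (Cplx a b) (Cplx (f n) (A (f n)))| ^+ 2) n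
      @[n --> \oo] --> (s%:C : (R[i] : numFieldType)) /\
    c * sqr_norm_rot a b <= s <= C * sqr_norm_rot a b.
Proof.
move=> fP a b.
have [pcvg /andP[pc pC]] := fP (a + T b).
have [qcvg /andP[qc qC]] := fP (b - T a).
exists (limn (series (fun n => `|inner (a + T b) (f n)| ^+ 2)) +
        limn (series (fun n => `|inner (b - T a) (f n)| ^+ 2))); split; last first.
  by rewrite /sqr_norm_rot !mulrDr; apply/andP; split; apply: lerD.
have partial_sums n :
    series (fun k => `|inner (Cplx a b) (Cplx (f k) (A (f k)))| ^+ 2) n =
    (series (fun k => `|inner (a + T b) (f k)| ^+ 2) n +
     series (fun k => `|inner (b - T a) (f k)| ^+ 2) n)%:C.
  rewrite !seriesEnat /= -big_split /= rmorph_sum /=; apply: eq_bigr => k _.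
  by rewrite sqr_norm_inner_rot !real_normK ?num_real.
under eq_fun do rewrite partial_sums.
exact: cvg_real_complex (cvgD pcvg qcvg).
Qed.

(** T + i is bounded below, in squared norms and real components. *)
Definition rot_bounded_below := exists2 d : R, 0 < d &
  forall a b, d * (`|a| ^+ 2 + `|b| ^+ 2) <= sqr_norm_rot a b.

(** Boundedness of T + i, the source of the upper frame bound. *)
Lemma sqr_norm_rot_le a b :
  sqr_norm_rot a b <= 2 * (1 + M ^+ 2) * (`|a| ^+ 2 + `|b| ^+ 2).
Proof.
have TM := adjoint_bounded adjAT A_bounded.
have T2 y : `|T y| ^+ 2 <= M ^+ 2 * `|y| ^+ 2.
  by rewrite -exprMn lerXn2r ?nnegrE // (le_trans _ (TM y)).
have D2 x y : `|x + y| ^+ 2 <= 2 * (`|x| ^+ 2 + `|y| ^+ 2).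
  by have := sqr_ge0 `|x - y|; rewrite sqr_normD sqr_normB; lra.
have := D2 a (T b); have := D2 b (- T a); rewrite normrN.
have := T2 a; have := T2 b; rewrite /sqr_norm_rot.
have -> : 2 * (1 + M ^+ 2) * (`|a| ^+ 2 + `|b| ^+ 2) = 2 * `|a| ^+ 2
  + 2 * `|b| ^+ 2 + 2 * (M ^+ 2 * `|a| ^+ 2) + 2 * (M ^+ 2 * `|b| ^+ 2) by ring.
lra.
Qed.

Lemma rot_frameP (f : nat -> H) : frame f ->
  frame (fun n => Cplx (f n) (A (f n))) <-> rot_bounded_below.
Proof.
move=> [c [C [c0 cC fP]]].
have C0 : 0 < C := lt_le_trans c0 cC.
have coefs := cvg_coefs_rot fP.
split=> [[_ [C' [/complex_gt0[k k0 ->] _ rfP]]]|[d d0 dP]].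
  exists (k / C); first by rewrite divr_gt0.
  move=> a b; have [s [scvg /andP[_ sC]]] := coefs a b.
  have [_ /andP[+ _]] := rfP (Cplx a b).
  rewrite (cvg_lim _ scvg) // sqr_norm_Cplx -rmorphM /= lecR => ks.
  by rewrite mulrAC ler_pdivrMr // mulrC [leRHS]mulrC (le_trans _ sC) // mulrC.
(* The summand [d] secures d <= D, so that the two frame bounds are ordered. *)
pose D := 2 * (1 + M ^+ 2) + d.
have dD : d <= D by rewrite lerDr mulr_ge0 // addr_ge0 // sqr_ge0.
exists (c * d)%:C, (C * D)%:C; split.
- by rewrite ltcR mulr_gt0.
- by rewrite lecR ler_pM // ltW.
move=> [a b] /=; have [s [scvg /andP[cs sC]]] := coefs a b.
split; first exact: cvgP scvg.
rewrite (cvg_lim _ scvg) // sqr_norm_Cplx -!rmorphM /= !lecR; apply/andP; split.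
  by apply: le_trans cs; rewrite -mulrA ler_pM2l.
apply: le_trans sC _; rewrite -mulrA ler_pM2l //.
apply: le_trans (sqr_norm_rot_le a b) _.
by rewrite ler_wpM2r ?addr_ge0 ?sqr_ge0 // lerDl ltW.
Qed.

Lemma norm_extend_rot a b :
  `|extend T (Cplx a b) - (- 'i) *: Cplx a b| = (Num.sqrt (sqr_norm_rot a b))%:C.
Proof.
rewrite (_ : `|_| = cnorm (extend T (Cplx a b) - (- 'i) *: Cplx a b)) // /cnorm /=.
rewrite !oppr0 !scale0r !scaleN1r sub0r addr0 opprK.
by rewrite /sqr_norm_rot addrC [T b + _]addrC opprK -[`|b - _|]normrN opprB.
Qed.

Lemma approximate_point_rotP :
  ~ approximate_point_spectrum (extend T) (- 'i) <-> rot_bounded_below.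
Proof.
split=> [napp|[d d0 dP] [u [u1 u0]]]; last first.
  have sd0 : 0 < (Num.sqrt d)%:C :> R[i] by rewrite ltcR sqrtr_gt0.
  move/cvgr0Pnorm_lt : u0 => /(_ _ sd0) [N _ /(_ N (leqnn N))] /=.
  have := congr1 (fun z => z ^+ 2) (u1 N); case: (u N) => a b.
  rewrite sqr_norm_Cplx expr1n => -[ab1].
  rewrite norm_extend_rot normc_def /= expr0n addr0 sqrtr_sqr ltcR.
  rewrite ger0_norm ?sqrtr_ge0 // ltNge => /negP; apply.
  have := dP a b; rewrite ab1 mulr1 => ddP.
  by rewrite ler_sqrt // (le_trans _ ddP) // ltW.
apply: contrapT => nbb; apply: napp.
(* Violating the lower bound for each constant 1/(n+1) gives vectors which, once normalized, form an
   approximate eigenvector sequence. *)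
have ex n : exists u : H * H,
    sqr_norm_rot u.1 u.2 < n.+1%:R^-1 * (`|u.1| ^+ 2 + `|u.2| ^+ 2).
  apply: contrapT => nex; apply: nbb; exists n.+1%:R^-1; first by rewrite invr_gt0.
  by move=> a b; rewrite leNgt; apply/negP => h; apply: nex; exists (a, b).
have [v vP] := choice ex.
pose N n := `|(v n).1| ^+ 2 + `|(v n).2| ^+ 2.
(* The strict inequality in [vP] excludes the zero vector, so normalizing is legitimate. *)
have N0 n : 0 < N n.
  rewrite -(@pmulr_rgt0 _ n.+1%:R^-1) ?invr_gt0 //.
  by apply: le_lt_trans (vP n); rewrite addr_ge0 ?sqr_ge0.
pose k n := (Num.sqrt (N n))^-1.
have k2 n : k n ^+ 2 = (N n)^-1 by rewrite exprVn sqr_sqrtr // ltW.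
have rotZ t a b : sqr_norm_rot (t *: a) (t *: b) = t ^+ 2 * sqr_norm_rot a b.
  rewrite /sqr_norm_rot !(adjointZ adjAT) -scalerDr -scalerBr !normrZ !exprMn.
  by rewrite real_normK ?num_real // mulrDr.
exists (fun n => Cplx (k n *: (v n).1) (k n *: (v n).2)); split.
  move=> n; rewrite (_ : `|_| = cnorm (Cplx (k n *: (v n).1) (k n *: (v n).2))) //.
  rewrite /cnorm /= !normrZ !exprMn real_normK ?num_real // -mulrDr k2.
  by rewrite mulVf ?sqrtr1 // gt_eqF // N0.
rewrite (_ : 0 = 0%:C) //; under eq_fun do rewrite norm_extend_rot.
apply: cvg_real_complex; apply/cvgr0Pnorm_lt => e e0; near=> n.
rewrite ger0_norm ?sqrtr_ge0 // rotZ k2.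
rewrite -[ltRHS]gtr0_norm // -sqrtr_sqr ltr_sqrt ?exprn_gt0 //.
rewrite mulrC ltr_pdivrMr //; apply: lt_trans (vP n) _.
rewrite (ltr_pM2r (N0 n)); near: n.
exact: near_infty_natSinv_lt (PosNum (exprn_gt0 2 e0)).
Unshelve. all: by end_near. Qed.

(* Eliminating one component of (A - i) (a + i b) = x + i y leaves
   (A^2 + 1) a = A x - y, and dually for T + i and T^2 + 1. *)
Let S : {linear H -> H} := (A \o A) \+ idfun.

Let S_bounded x : `|S x| <= (M ^+ 2 + 1) * `|x|.
Proof.
rewrite /S /= mulrDl mul1r; apply: le_trans (ler_normD _ _) _; rewrite lerD2r.
have [M0|M0] := leP 0 M.
  by apply: le_trans (A_bounded _) _; rewrite expr2 -mulrA ler_wpM2l.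
(* A negative [M] forces |A (A x)| <= 0. *)
apply: le_trans (_ : 0 <= _); last by rewrite mulr_ge0 ?sqr_ge0.
by apply: le_trans (A_bounded _) _; rewrite nmulr_rle0.
Qed.

Let adjS x y : inner (S x) y = inner x (T (T y) + y).
Proof. by rewrite /S /= innerDl innerDr !adjAT. Qed.

Lemma surjectivity_rotE :
  ~ surjectivity_spectrum (extend A) 'i <-> forall y, exists x, S x = y.
Proof.
split=> [/contrapT surj y|Ssurj].
  (* A target with zero real part forces b = - A a, leaving (A^2 + 1) a = y. *)
  have [[a b] _] : range (fun u => extend A u - 'i *: u) (Cplx 0 (- y)).
    by rewrite surj.
  case; rewrite !scale0r !scale1r sub0r opprK addr0 => ab0 aby.
  have bE : b = - A a by apply/eqP; rewrite -addr_eq0 addrC ab0.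
  by exists a; apply: oppr_inj; rewrite -aby bE linearN opprD.
apply; apply/seteqP; split=> // -[x y] _.
have [a aE] := Ssurj (A x - y); exists (Cplx a (x - A a)) => //.
apply: complexification_eq => /=; rewrite !scale0r !scale1r ?sub0r ?addr0.
  by rewrite opprK addrC subrK.
rewrite linearB -addrA -opprD; move: aE; rewrite /S /= => ->.
by rewrite opprB addrC subrK.
Qed.

(** Rests on T^2 + 1 = (T - i) (T + i) = (T + i) (T - i): T - i is bounded, and it does not shrink
    real vectors. *)
Lemma rot_bounded_belowE : rot_bounded_below <->
  exists2 c : R, 0 < c & forall y, c * `|y| <= `|T (T y) + y|.
Proof.
split=> [[d d0 dP]|[c c0 cP]].
  exists (Num.sqrt d); first by rewrite sqrtr_gt0.
  move=> y; rewrite -ler_sqr ?nnegrE ?mulr_ge0 ?sqrtr_ge0 // exprMn sqr_sqrtr ?(ltW d0) //.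
  (* The vector y + i T y = i (T - i) y is sent by T + i to i (T^2 + 1) y. *)
  have := dP y (T y); rewrite /sqr_norm_rot subrr normr0 expr0n addr0 [y + _]addrC.
  by apply: le_trans; rewrite ler_pM2l // lerDl sqr_ge0.
have TM := adjoint_bounded adjAT A_bounded.
have D0 : 0 < 2 * (1 + M ^+ 2) by rewrite mulr_gt0 // ltr_pwDl // sqr_ge0.
(* With p + i q = (a + T b) + i (b - T a), one has (T^2 + 1) a = p - T q and (T^2 + 1) b = q + T p;
   squaring and adding these estimates produces 2 (1 + M^2). *)
exists (c ^+ 2 / (2 * (1 + M ^+ 2))); first by rewrite divr_gt0 ?exprn_gt0.
move=> a b; rewrite mulrAC ler_pdivrMr // /sqr_norm_rot.
set p := a + T b; set q := b - T a.
have ca : c * `|a| <= `|p| + M * `|q|.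
  apply: le_trans (cP a) _; rewrite (_ : _ + a = p - T q).
    by apply: le_trans (ler_normB _ _) _; rewrite lerD2l.
  by rewrite (adjointB adjAT) opprB addrACA subrr addr0 addrC.
have cb : c * `|b| <= `|q| + M * `|p|.
  apply: le_trans (cP b) _; rewrite (_ : _ + b = q + T p).
    by apply: le_trans (ler_normD _ _) _; rewrite lerD2l.
  by rewrite (adjointD adjAT) addrA subrK addrC.
have sq (x s t : R) : 0 <= x -> x <= s + M * t ->
    x ^+ 2 <= 2 * (s ^+ 2 + M ^+ 2 * t ^+ 2).
  move=> x0 xst; apply: le_trans (_ : (s + M * t) ^+ 2 <= _).
    by rewrite lerXn2r ?nnegrE // (le_trans x0).
  by have := sqr_ge0 (s - M * t); rewrite sqrrB sqrrD exprMn; lra.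
have := sq _ _ _ (mulr_ge0 (ltW c0) (normr_ge0 a)) ca.
have := sq _ _ _ (mulr_ge0 (ltW c0) (normr_ge0 b)) cb.
rewrite !exprMn; set P := `|p| ^+ 2; set Q := `|q| ^+ 2; nra.
Qed.

Lemma surjectivity_rotP :
  ~ surjectivity_spectrum (extend A) 'i <-> rot_bounded_below.
Proof.
split=> [/surjectivity_rotE|/rot_bounded_belowE[c c0 cP]].
  by move=> /(surjective_adjoint_bounded_below adjS) /rot_bounded_belowE.
apply/surjectivity_rotE.
exact: (adjoint_bounded_below_surjective S_bounded adjS c0 cP).
Qed.

End RotatedSpectrum.

Theorem theorem3p13 (R : realType) (H : realHilbertType R)
    (H_infdim : infinite_dimensional H) (H_sep : separable H)
    (A : {linear H -> H}) (A_bounded : bounded_operator A) :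
  [<-> forall f : nat -> H, frame f -> frame (fun n => Cplx (f n) (A (f n)));
       exists2 f : nat -> H, frame f & frame (fun n => Cplx (f n) (A (f n)));
       ~ surjectivity_spectrum (extend A) 'i%C;
       ~ approximate_point_spectrum (extend (adjoint A)) (- 'i%C)].
Proof.
have adjA := inner_adjoint A_bounded; have [M AM] := A_bounded.
have frameP := rot_frameP AM adjA; have surP := surjectivity_rotP AM adjA.
have appP := approximate_point_rotP adjA.
tfae.
- by move=> frames; have [f ff] := separable_frame H_sep; exists f => //; exact: frames.
- by move=> [f ff /(frameP _ ff)] /surP.
- by move=> /surP /appP.
(* The lower bound [bb] does not mention [f], hence serves every frame. *)
- by move=> /appP bb f ff; apply/(frameP _ ff).
Qed.
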